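(* Let $G=(V,E)$ be a finite graph with integer vertex-constraints $(b_v)_{v\in V}$ and edge-constraints $(c_e)_{e\in E}$, and let $\lambda>0$. The fixed point equation $\mathbf m=\mathcal R_G^{(\lambda)}[\mathbf m]$ has a unique solution $\mathbf m^{(\lambda)}\in\widetilde{\mathcal P}^{\overrightarrow E}$, and synchronous BP message updates $\mathbf m^{t+1}=\mathcal R_G^{(\lambda)}[\mathbf m^t]$, $t\ge0$, converge to $\mathbf m^{(\lambda)}$ as $t\to\infty$, from any initialization $\mathbf m^0\in\widetilde{\mathcal P}^{\overrightarrow E}$.
   Context: $\mathbb N=\{0,1,\dots\}$. $\widetilde{\mathcal P}$ is the set of probability distributions on $\mathbb N$ with bounded support whose support is an interval of integers containing $0$. $\overrightarrow E$ is the set of directed edges of $G$, comprising $\overrightarrow{uv}$ and $\overrightarrow{vu}$ for each $uv\in E$. For $\overrightarrow e=\overrightarrow{vu}$, $\partial\overrightarrow e=\{\overrightarrow{wv}:w\sim v,\ w\ne u\}$. A message on a directed edge with capacity $c_e$ is a distribution supported in $\{0,\dots,c_e\}$. For a finite index set $S$, $\mathbf m_S(\mathbf y)=\prod_{i\in S}m_i(y_i)$ and $|\mathbf y|=\sum_{i\in S}y_i$. For $\overrightarrow e=\overrightarrow{vu}$, $$\mathcal R^{(\lambda)}_{\overrightarrow e}[\mathbf m](x)=\frac{\lambda^x\mathbf 1(x\le c_{vu})\sum_{|\mathbf y|\le b_v-x}\mathbf m_{\partial\overrightarrow e}(\mathbf y)}{\sum_{0\le t\le c_{vu}}\lambda^t\sum_{|\mathbf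 y|\le b_v-t}\mathbf m_{\partial\overrightarrow e}(\mathbf y)},\qquad \mathcal R_G^{(\lambda)}[\mathbf m]=\big(\mathcal R^{(\lambda)}_{\overrightarrow e}[\mathbf m]\big)_{\overrightarrow e\in\overrightarrow E}.$$ Convergence is componentwise and pointwise on $\mathbb N$. *)

(* Defs.v *)
From mathcomp Require Import all_boot all_order all_algebra.
From mathcomp Require Import all_classical all_reals all_analysis.
Set Implicit Arguments.
Unset Strict Implicit.
Unset Printing Implicit Defensive.
Import Order.TTheory GRing.Theory Num.Theory numFieldNormedType.Exports.
Local Open Scope classical_set_scope.
Local Open Scope ring_scope.

(* m is the mass function of a distribution on nat whose support is bounded and
   is an interval of integers containing 0. *)
Record Ptilde (R : realType) (m : nat -> R) : Prop := {
  Ptilde_ge0 : forall x, 0 <= m x ;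
  Ptilde_sum1 : series m @ \oo --> (1 : R) ;
  Ptilde_bounded : exists n : nat, forall x, m x != 0 -> (x <= n)%N ;
  Ptilde_interval : forall i j k : nat,
    (i <= j <= k)%N -> m i != 0 -> m k != 0 -> m j != 0 ;
  Ptilde_supp0 : m 0%N != 0 }.

Section BeliefPropagation.
Context (V : finType) (adj : rel V).

(* A simple graph is a symmetric irreflexive adj; the pair (v, u) stands for
   the directed edge from v to u. *)
Definition dedge : Type := {p : V * V | adj p.1 p.2}.

Definition dsrc (e : dedge) : V := (val e).1.
Definition ddst (e : dedge) : V := (val e).2.

Definition uedge (e : dedge) : {set V} := [set dsrc e; ddst e].

(* For e from v to u, the edges from w to v with w != u; adjacency of w and v
   is part of the type dedge. *)
Definition dpred (e : dedge) : {set dedge} :=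
  [set d | (ddst d == dsrc e) && (dsrc d != ddst e)].

Section Update.
Context (R : realType) (b : V -> nat) (c : {set V} -> nat) (lambda : R).

Definition messages : Type := dedge -> nat -> R.

(* The sum of m_{dpred e}(y) over |y| <= b_v - x, with v = dsrc e.
   The constraint forces y_d <= b_v, so y may take its values in 'I_(b_v).+1;
   writing it |y| + x <= b_v (not with truncated subtraction) makes the sum
   empty when x > b_v. *)
Definition bp_sum (m : messages) (e : dedge) (x : nat) : R :=
  \sum_(y : {ffun {d : dedge | d \in dpred e} -> 'I_(b (dsrc e)).+1}
        | ((\sum_d y d)%N + x <= b (dsrc e))%N)
    \prod_d m (val d) (y d).

(* c is indexed by unordered pairs; only its values on edges are used. *)
Definition bp_update (m : messages) : messages := fun e x =>
  lambda ^+ x * (x <= c (uedge e))%N%:R * bp_sum m e x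
  / \sum_(0 <= t < (c (uedge e)).+1) lambda ^+ t * bp_sum m e t.

End Update.
End BeliefPropagation.

Arguments messages {V} adj R.
Arguments bp_update {V adj R} b c lambda m.

(* Main.v *)
Require Import Defs.
From mathcomp Require Import all_boot all_order all_algebra.
From mathcomp Require Import all_classical all_reals all_analysis.
From mathcomp Require Import zify ring lra.
Set Implicit Arguments.
Unset Strict Implicit.
Unset Printing Implicit Defensive.
Import Order.TTheory GRing.Theory Num.Theory numFieldNormedType.Exports.
Local Open Scope classical_set_scope.
Local Open Scope ring_scope.

(** Write f <= g for the upshifted likelihood ratio order ([lru] below):
    f(i+k+l) g(i) <= f(i+l) g(i+k) for all i, k, l.  It is not reflexive
    (f <= f says that f is log-concave), but the point mass at 0 is below every
    nonnegative function, log-concave or not, and this is what makes arbitrary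
    initial messages tractable.

    The order is preserved by convolution ([lruM]), hence by passing from
    messages to the distribution function of a sum of independent messages
    ([lru_prod], [lru_cumcoef]).  As the update at x is, up to normalisation and
    the factor lambda^x, that distribution function at b - x, the update map R
    reverses the order ([bp_update_antitone]).  Iterating R on the inequality
    delta_0 <= R^j(m) gives R^t(delta_0) <= R^(t+j)(m) for t even and the
    opposite inequality for t odd ([iterate_sandwich]).

    In the order f <= g the ratios f(x)/f(0) are at most g(x)/g(0), so along the
    iterates of delta_0 these ratios increase at even times and decrease at odd
    times.  They converge to two normalised messages m- <= m+ that R exchanges,
    and everything follows if m- = m+: the ratios of any trajectory are then
    squeezed between two sequences with the same limit.

    The equality m- = m+ ([bp_period2_eq]) is a double counting argument.  For
    messages m, let D_v(m) be the mean of the sum of the incoming values at v,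
    drawn independently from m and conditioned to have a sum at most b_v.  It is
    the sum over the edges d into v of the mean of the value on d.  When m is
    normalised on the capacities, the conditional law of that value is
    proportional to m_d(x) R(m)_d'(x) lambda^-x, where d' is the reverse of d
    ([edge_weight]).  For m = m- and R(m) = m+ this expression is turned into
    the one for m = m+ by reversing d, so the sums over all v of D_v(m-) and of
    D_v(m+) agree ([sum_vertex_mean_sym]).  But D_v is monotone ([lru_moment]),
    so D_v(m-) = D_v(m+) at each v, and equality in the monotonicity forces
    m-_d and m+_d to be proportional on {0, ..., b_v} for every d into v
    ([lru_moment_eq], [coef_ratioM_eq]).  These are the only values that R
    reads, hence m+ = R(m-) = R(m+) = m-. *)

(** * The upshifted likelihood ratio order *)

Section Order.
Variable R : realFieldType.
Implicit Types (f g : nat -> R) (w W : int -> R).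

Definition lru f g := forall i k l : nat,
  f (i + k + l)%N * g i <= f (i + l)%N * g (i + k)%N.

Lemma lru_at0 f g x : lru f g -> f x * g 0%N <= g x * f 0%N.
Proof. by move=> /(_ 0%N x 0%N); rewrite !addn0 !add0n [X in _ <= X]mulrC. Qed.

Lemma eq_sum_ord (F : nat -> R) (M N : nat) :
  (forall p, (minn M N <= p)%N -> F p = 0) -> \sum_(p < M) F p = \sum_(p < N) F p.
Proof.
wlog leMN : M N / (M <= N)%N.
  move=> H F0; case: (leqP M N) => [/H|/ltnW/H]; first by apply.
  by move=> H'; rewrite H' // minnC.
move/minn_idPl: (leMN) => -> F0.
rewrite -(subnKC leMN) big_split_ord /= [X in _ = _ + X]big1 ?addr0 // => i _.
by rewrite F0 // leq_addr.
Qed.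

(** The values beyond s/2 are dominated by those at all points at least as close
    to the centre s/2.  For w p = f p * g (s - p), this is the part of [lru f g]
    in which the two arguments have sum s; see [rdom_lru]. *)
Definition rdom (s : nat) w := forall x y : int, s%:Z - x <= y <= x -> w x <= w y.

(** Convolution preserves [rdom] when W is symmetric: the reflection p -> K - p
    exchanges W (B - p) and W (D - p), so that twice the difference of the two
    sides is the sum of
    (w p - w (K - p)) * (W (B - p) - W (D - p)),
    where both factors are nonnegative if 2 p <= K and nonpositive if K <= 2 p. *)
Lemma conv_rdom_sym (s S B D M : nat) w W :
    rdom s w -> rdom S W -> (forall x, W (S%:Z - x) = W x) ->
    (forall x, x < 0 \/ s%:Z < x -> w x = 0) ->
    (s + S <= B + D)%N -> (B <= D)%N -> (s < M)%N ->
  \sum_(p < M) w p%:Z * W (D%:Z - p%:Z) <= \sum_(p < M) w p%:Z * W (B%:Z - p%:Z).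
Proof.
move=> wP WP Wsym w0 sSBD leBD ltsM; rewrite -subr_ge0 -sumrB.
pose K := (B + D - S)%N.
(* s <= K by the hypothesis on s + S, so that p <= K covers the support of w. *)
have -> : \sum_(p < M) (w p%:Z * W (B%:Z - p%:Z) - w p%:Z * W (D%:Z - p%:Z)) =
    \sum_(p < K.+1) (w p%:Z * (W (B%:Z - p%:Z) - W (D%:Z - p%:Z))).
  under eq_bigr do rewrite -mulrBr.
  apply: (@eq_sum_ord (fun p => w p%:Z * (W (B%:Z - p%:Z) - W (D%:Z - p%:Z)))).
  by move=> p; rewrite geq_min => Hp; rewrite w0 ?mul0r //; right; rewrite /K in Hp; lia.
set T := \sum_(p < _) _.
suff : 0 <= T + T by lra.
have {2}-> : T = \sum_(p < K.+1) w (K%:Z - p%:Z) * (W (D%:Z - p%:Z) - W (B%:Z - p%:Z)).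
  rewrite /T (reindex_inj rev_ord_inj) /=; apply: eq_bigr => p _.
  have pK := ltn_ord p.
  have -> : (K.+1 - p.+1)%N%:Z = K%:Z - p%:Z by lia.
  rewrite -[W (D%:Z - p%:Z)]Wsym -[W (B%:Z - p%:Z)]Wsym /K.
  congr (_ * (W _ - W _)); lia.
rewrite -big_split /=; apply: sumr_ge0 => p _.
have pK := ltn_ord p.
have -> : w p%:Z * (W (B%:Z - p%:Z) - W (D%:Z - p%:Z)) +
  w (K%:Z - p%:Z) * (W (D%:Z - p%:Z) - W (B%:Z - p%:Z)) =
  (w p%:Z - w (K%:Z - p%:Z)) * (W (B%:Z - p%:Z) - W (D%:Z - p%:Z)) by ring.
have [le2|gt2] := leqP (p + p) K.
  rewrite mulr_ge0 // subr_ge0; [apply: wP|apply: WP]; rewrite /K in le2 pK *; lia.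
rewrite mulr_le0 // subr_le0; first by apply: wP; rewrite /K in gt2 pK *; lia.
rewrite -Wsym -[W (D%:Z - p%:Z)]Wsym; apply: WP; rewrite /K in gt2 pK *; lia.
Qed.

(** The general case: W is a symmetric function H with the same property plus a
    nonnegative excess N supported to the left of the centre S/2.  In the
    convolution with N, the inequality holds term by term, because w is
    evaluated at D - x and B - x with x < S/2. *)
Lemma conv_rdom (s S B D M : nat) w W :
    rdom s w -> rdom S W ->
    (forall x, x < 0 \/ s%:Z < x -> w x = 0) ->
    (forall x, x < 0 \/ S%:Z < x -> W x = 0) ->
    (s + S <= B + D)%N -> (B <= D)%N -> (s < M)%N ->
  \sum_(p < M) w p%:Z * W (D%:Z - p%:Z) <= \sum_(p < M) w p%:Z * W (B%:Z - p%:Z).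
Proof.
move=> wP WP w0 W0 sSBD leBD ltsM.
pose H x := W (Num.max x (S%:Z - x)).
pose N x := W x - H x.
have N_ge0 x : 0 <= N x by rewrite subr_ge0; apply: WP; lia.
have N0 x : x < 0 \/ S%:Z <= x + x -> N x = 0.
  move=> Hx; apply/eqP; rewrite subr_eq0 /H.
  have [xS|xS] := lerP (S%:Z - x) x; first by [].
  by rewrite !W0 //; lia.
have WHN x : H x + N x = W x by rewrite addrC subrK.
have WE (E : int) : \sum_(p < M) w p%:Z * W (E - p%:Z) =
    \sum_(p < M) w p%:Z * H (E - p%:Z) + \sum_(p < M) w p%:Z * N (E - p%:Z).
  by rewrite -big_split; apply: eq_bigr => p _ /=; rewrite -mulrDr -WHN.
rewrite !WE; apply: lerD.
  apply: (@conv_rdom_sym s S) => //.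
  - by move=> x y xy; rewrite /H; apply: WP; lia.
  - by move=> x; rewrite /H; congr W; lia.
(* Summing over the argument x of N makes the comparison termwise. *)
have rev (E : nat) : \sum_(p < M) w p%:Z * N (E%:Z - p%:Z) =
    \sum_(x < (S + E).+1) w (E%:Z - x%:Z) * N x%:Z.
  rewrite (@eq_sum_ord (fun p => w p%:Z * N (E%:Z - p%:Z)) M E.+1); last first.
    move=> p; rewrite geq_min => /orP[Mp|Ep].
      by rewrite w0 ?mul0r //; lia.
    by rewrite N0 ?mulr0 //; lia.
  rewrite -(@eq_sum_ord (fun x => w (E%:Z - x%:Z) * N x%:Z) E.+1); last first.
    move=> p; rewrite geq_min => Ep; rewrite w0 ?mul0r //; lia.
  rewrite (reindex_inj rev_ord_inj) /=; apply: eq_bigr => p _.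
  have pE := ltn_ord p; congr (w _ * N _); lia.
rewrite !rev.
rewrite (@eq_sum_ord (fun x => w (D%:Z - x%:Z) * N x%:Z) _ (S + B).+1); last first.
  by move=> x; rewrite geq_min => Hx; rewrite N0 ?mulr0 //; lia.
apply: ler_sum => x _.
have [xS|xS] := lerP S%:Z (x%:Z + x%:Z).
  by rewrite N0 ?mulr0 //; right.
by rewrite ler_wpM2r //; apply: wP; lia.
Qed.

(** Coefficients extended by 0 to negative indices: the ranges of convolution
    sums become independent of the indices, which simplifies reindexing. *)
Definition zcoef (p : {poly R}) (z : int) : R := if z is Posz n then p`_n else 0.

Definition nneg_poly (p : {poly R}) := forall i, 0 <= p`_i.

Lemma zcoef_ge0 (p : {poly R}) z : nneg_poly p -> 0 <= zcoef p z.
Proof. by move=> p0; case: z => //= n. Qed.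

Lemma zcoef_lt0 (p : {poly R}) z : z < 0 -> zcoef p z = 0.
Proof. by case: z. Qed.

Lemma zcoefM (p q : {poly R}) (n M : nat) : (n < M)%N ->
  (p * q)`_n = \sum_(j < M) zcoef p j%:Z * zcoef q (n%:Z - j%:Z).
Proof.
move=> nM; rewrite coefM.
rewrite -(@eq_sum_ord (fun j => zcoef p j%:Z * zcoef q (n%:Z - j%:Z)) n.+1).
  apply: eq_bigr => j _ /=; have jn := ltn_ord j.
  by have -> : n%:Z - j%:Z = (n - j)%N%:Z by lia.
by move=> j; rewrite geq_min => Hj; rewrite [X in _ * X]zcoef_lt0 ?mulr0 //; lia.
Qed.

(** A product of two convolutions, sorted by the sum s of the indices in the
    first factors; for fixed s it is a convolution of two functions of the kind
    to which [rdom_lru] applies. *)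
Lemma coefM_coefM (p1 p2 q1 q2 : {poly R}) (D n : nat) : (D <= n)%N ->
  (p1 * p2)`_D * (q1 * q2)`_(n - D) =
  \sum_(s < n.+1) \sum_(j < n.+1)
     (zcoef p1 j%:Z * zcoef q1 (s%:Z - j%:Z)) *
     (zcoef p2 (D%:Z - j%:Z) * zcoef q2 ((n - s)%N%:Z - (D%:Z - j%:Z))).
Proof.
move=> Dn; rewrite (@zcoefM _ _ D n.+1) // exchange_big mulr_suml /=.
apply: eq_bigr => j _; have jn := ltn_ord j.
have [jD|Dj] := leqP j D; last first.
  rewrite [zcoef p2 _]zcoef_lt0 ?mulr0 ?mul0r; last by lia.
  by rewrite big1 // => s _; rewrite mul0r mulr0.
transitivity (zcoef p1 j%:Z * zcoef p2 (D%:Z - j%:Z) * (q1 * q2)`_(n - D)) => //.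
rewrite (@zcoefM _ _ (n - D) (n - j).+1); last by lia.
pose G (s : nat) := zcoef q1 (s%:Z - j%:Z) * zcoef q2 ((n - s)%N%:Z - (D%:Z - j%:Z)).
transitivity (zcoef p1 j%:Z * zcoef p2 (D%:Z - j%:Z) * \sum_(s < n.+1) G s); last first.
  by rewrite mulr_sumr; apply: eq_bigr => s _; rewrite /G mulrACA.
congr (_ * _).
have en : n.+1 = (j + (n - j).+1)%N by lia.
rewrite [in RHS]en big_split_ord /= [X in _ = X + _]big1 ?add0r.
  apply: eq_bigr => s _; rewrite /G; have sn := ltn_ord s.
  rewrite -[q1`_s]/(zcoef q1 s%:Z); congr (zcoef _ _ * zcoef _ _); lia.
by move=> s _; rewrite /G zcoef_lt0 ?mul0r //; have := ltn_ord s; lia.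
Qed.

Lemma rdom_lru (p q : {poly R}) (s : nat) : nneg_poly p -> nneg_poly q ->
  lru (nth 0 p) (nth 0 q) -> rdom s (fun x => zcoef p x * zcoef q (s%:Z - x)).
Proof.
move=> p0 q0 pq x y xy.
have [sx|sx] := ltrP (s%:Z - x) 0.
  by rewrite [zcoef q _]zcoef_lt0 // mulr0 mulr_ge0 // zcoef_ge0.
have := pq (absz (s%:Z - x)%R) (absz (x - y)%R) (absz (y - (s%:Z - x))%R).
have -> : s%:Z - x = Posz (absz (s%:Z - x)%R) by lia.
have -> : s%:Z - y = Posz (absz (s%:Z - x)%R + absz (x - y)%R) by lia.
set u := absz (s%:Z - x)%R; set a := absz (x - y)%R; set c := absz (y - _)%R.
have -> : x = Posz (u + a + c) by lia.
by have -> : y = Posz (u + c) by lia.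
Qed.

(** Convolution preserves the order.  This cannot be done one factor at a time,
    as the order is not reflexive; [coefM_coefM] reduces it to [conv_rdom]. *)
Lemma lruM (p1 p2 q1 q2 : {poly R}) :
    nneg_poly p1 -> nneg_poly p2 -> nneg_poly q1 -> nneg_poly q2 ->
    lru (nth 0 p1) (nth 0 q1) -> lru (nth 0 p2) (nth 0 q2) ->
  lru (nth 0 (p1 * p2)) (nth 0 (q1 * q2)).
Proof.
move=> p10 p20 q10 q20 pq1 pq2 i k l.
pose n := (i + i + k + l)%N.
have {2}-> : i = (n - (i + k + l))%N by rewrite /n; lia.
have -> : (q1 * q2)`_(i + k) = (q1 * q2)`_(n - (i + l)) by congr nth; rewrite /n; lia.
rewrite !coefM_coefM; [|rewrite /n; lia..].
apply: ler_sum => s _; have sn := ltn_ord s.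
apply: (@conv_rdom s (n - s) (i + l) (i + k + l) n.+1
  (fun x => zcoef p1 x * zcoef q1 (s%:Z - x))
  (fun x => zcoef p2 x * zcoef q2 ((n - s)%N%:Z - x))); try (rewrite /n in sn *; lia).
- exact: rdom_lru.
- exact: rdom_lru.
- move=> x [x0|xs]; first by rewrite zcoef_lt0 // mul0r.
  by rewrite [zcoef q1 _]zcoef_lt0 ?mulr0 //; lia.
- move=> x [x0|xs]; first by rewrite zcoef_lt0 // mul0r.
  by rewrite [zcoef q2 _]zcoef_lt0 ?mulr0 //; lia.
Qed.
End Order.

(** * Cumulative sums and first moments *)

Section Cumulative.
Variable R : realFieldType.
Implicit Types p q : {poly R}.

Lemma nneg_polyM p q : nneg_poly p -> nneg_poly q -> nneg_poly (p * q).
Proof. by move=> p0 q0 i; rewrite coefM sumr_ge0 // => j _; rewrite mulr_ge0. Qed.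

Lemma nneg_poly_prod (I : finType) (A : {pred I}) (P : I -> {poly R}) :
  (forall i, nneg_poly (P i)) -> nneg_poly (\prod_(i in A) P i).
Proof.
move=> P0; apply: big_ind => // [i|]; last exact: nneg_polyM.
by rewrite coef1 ler0n.
Qed.

Lemma coef0_prod (I : finType) (A : {pred I}) (P : I -> {poly R}) :
  (\prod_(i in A) P i)`_0 = \prod_(i in A) (P i)`_0.
Proof. by rewrite (big_morph (fun p => p`_0) (@coef0M R) (coef1 R 0)). Qed.

Lemma lru_prod (I : finType) (A : {pred I}) (P Q : I -> {poly R}) :
    (forall i, nneg_poly (P i)) -> (forall i, nneg_poly (Q i)) ->
    (forall i, lru (nth 0 (P i)) (nth 0 (Q i))) ->
  lru (nth 0 (\prod_(i in A) P i)) (nth 0 (\prod_(i in A) Q i)).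
Proof.
move=> P0 Q0 PQ.
pose K p q := [/\ nneg_poly p, nneg_poly q & lru (nth 0 p) (nth 0 q)].
suff [] : K (\prod_(i in A) P i) (\prod_(i in A) Q i) by [].
apply: (big_ind2 K) => //; last first.
  by move=> p1 q1 p2 q2 [? ? ?] [? ? ?]; split; [exact: nneg_polyM..|exact: lruM].
by split=> [i|i|i k l]; rewrite !coef1 -?natrM ?ler0n ?ler_nat //; case: i k l => [|i] [|k] [|l].
Qed.

Definition cumcoef p n := \sum_(j < n.+1) p`_j.

(** Cumulative sums are convolutions with an initial segment of the sequence
    1, 1, ..., which is log-concave, that is, below itself in the order; this
    reduces [lru_cumcoef] to [lruM]. *)
Lemma cumcoefE p n N : (n < N)%N -> cumcoef p n = (p * \poly_(j < N) 1)`_n.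
Proof.
move=> nN; rewrite coefM; apply: eq_bigr => j _.
by rewrite coef_poly ifT ?mulr1 //; lia.
Qed.

Lemma cumcoef_ge0 p n : nneg_poly p -> 0 <= cumcoef p n.
Proof. by move=> p0; apply: sumr_ge0. Qed.

Lemma cumcoef_gt0 p n : nneg_poly p -> 0 < p`_0 -> 0 < cumcoef p n.
Proof.
by move=> p0 p00; rewrite /cumcoef big_ord_recl ltr_wpDr // sumr_ge0.
Qed.

Lemma cumcoefM p q n :
  cumcoef (p * q) n = \sum_(x < n.+1) p`_x * cumcoef q (n - x).
Proof.
rewrite (@cumcoefE _ _ n.+1) // -mulrA coefM; apply: eq_bigr => x _.
by rewrite (@cumcoefE _ _ n.+1) //; lia.
Qed.

Lemma lru_cumcoef p q : nneg_poly p -> nneg_poly q ->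
  lru (nth 0 p) (nth 0 q) -> lru (cumcoef p) (cumcoef q).
Proof.
move=> p0 q0 pq i k l; pose N := (i + k + l).+1.
rewrite !(@cumcoefE _ _ N); try (rewrite /N; lia).
have U0 : nneg_poly (\poly_(j < N) (1 : R)).
  by move=> j; rewrite coef_poly; case: ifP.
apply: lruM => // i' k' l'; rewrite !coef_poly.
case: ltnP => [ltN|_]; last by rewrite mul0r mulr_ge0 //; case: ifP.
by rewrite !ifT //; lia.
Qed.

Definition moment p n := \sum_(j < n.+1) j%:R * p`_j.

Lemma moment_deriv p n : moment p n = cumcoef ('X * p^`()) n.
Proof.
apply: eq_bigr => -[[|j] jn] _; rewrite coefXM /= ?mul0r //.
by rewrite coef_deriv mulr_natl.
Qed.

Lemma deriv_prod_seq (I : eqType) (r : seq I) (P : I -> {poly R}) : uniq r ->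
  (\prod_(i <- r) P i)^`() =
  \sum_(i <- r) (P i)^`() * \prod_(j <- r | j != i) P j.
Proof.
elim: r => [_|a r IH /andP[ar ur]]; first by rewrite !big_nil derivC.
rewrite !big_cons derivM eqxx /= IH //; congr (_ * _ + _).
  rewrite big_seq [RHS]big_seq_cond; apply: eq_bigl => j.
  by case: (boolP (j \in r)) => //= jr; apply/esym; apply: contraNneq ar => <-.
rewrite mulr_sumr; apply: eq_big_seq => i ir.
rewrite big_cons ifT; first by rewrite mulrCA.
by apply: contraNneq ar => ->.
Qed.

(** The first moment of a sum of independent variables, restricted to the event
    that the sum is at most n, splits into the contributions of the variables:
    this is the Leibniz rule for the operator p -> 'X * p^`(). *)
Lemma moment_prod (I : finType) (A : {pred I}) (P : I -> {poly R}) n :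
  moment (\prod_(i in A) P i) n =
  \sum_(i in A) \sum_(x < n.+1)
     x%:R * (P i)`_x * cumcoef (\prod_(j in A | j != i) P j) (n - x).
Proof.
rewrite moment_deriv -big_enum deriv_prod_seq ?enum_uniq // big_enum mulr_sumr.
rewrite {1}/cumcoef; under eq_bigr do rewrite coef_sum.
rewrite exchange_big /=; apply: eq_bigr => i _.
rewrite -/(cumcoef _ n) mulrA cumcoefM; apply: eq_bigr => x _.
rewrite big_enum_cond coefXM; congr (_ * _).
by case: (nat_of_ord x) => [|x'] /=; rewrite ?mul0r // coef_deriv mulr_natl.
Qed.

Section Mean.
Variables (p q : {poly R}) (n : nat).
Hypothesis pq : lru (nth 0 p) (nth 0 q).

(** The order makes the two factors have the same sign. *)
Let gap (i j : nat) := (j%:R - i%:R) * (q`_j * p`_i - q`_i * p`_j).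

Let gap_ge0 i j : 0 <= gap i j.
Proof.
rewrite /gap; have [ij|ji] := leqP i j.
  rewrite mulr_ge0 // subr_ge0 ?ler_nat //.
  by have := pq i (j - i)%N 0%N; rewrite !addn0 subnKC // mulrC [X in _ <= X -> _]mulrC.
rewrite mulr_le0 // subr_le0 ?ler_nat 1?ltnW //.
have := pq j (i - j)%N 0%N; rewrite !addn0 subnKC 1?ltnW //; lra.
Qed.

Let moment_gap :
  (moment q n * cumcoef p n - moment p n * cumcoef q n) *+ 2 =
  \sum_(i < n.+1) \sum_(j < n.+1) gap i j.
Proof.
have dist (f g : 'I_n.+1 -> R) : (\sum_(i < n.+1) f i) * (\sum_(j < n.+1) g j) =
    \sum_(i < n.+1) \sum_(j < n.+1) f i * g j.
  by rewrite mulr_suml; apply: eq_bigr => i _; rewrite mulr_sumr.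
rewrite mulr2n {1}[moment q n * _]mulrC {1}[moment p n * _]mulrC.
rewrite /moment /cumcoef !dist -!sumrB -big_split /=; apply: eq_bigr => i _.
rewrite -!sumrB -big_split /=; apply: eq_bigr => j _; rewrite /gap; ring.
Qed.

(** The conditional mean moment p n / cumcoef p n is monotone in p. *)
Lemma lru_moment : moment p n * cumcoef q n <= moment q n * cumcoef p n.
Proof.
rewrite -subr_ge0 -(@pmulrn_lge0 _ _ 2) // moment_gap.
by do 2! apply: sumr_ge0 => ? _.
Qed.

(** Equal conditional means force every gap to vanish; the gaps with i = 0 say that p and q
    are proportional up to n. *)
Lemma lru_moment_eq j : moment p n * cumcoef q n = moment q n * cumcoef p n ->
  (j <= n)%N -> p`_j * q`_0 = p`_0 * q`_j.
Proof.
move=> E jn; case: j jn => [//|j] jn.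
have := moment_gap; rewrite E subrr mul0rn => /esym.
have row0 (i : 'I_n.+1) : 0 <= \sum_(j < n.+1) gap i j by apply: sumr_ge0.
move/psumr_eq0P => /(_ (fun i _ => row0 i)) /(_ ord0 isT).
move/psumr_eq0P => /(_ (fun j _ => gap_ge0 _ j)).
move=> /(_ (Ordinal (jn : (j.+1 < n.+1)%N)) isT) /eqP.
rewrite /gap /= subr0 mulf_eq0 pnatr_eq0 /= subr_eq0 => /eqP; lra.
Qed.
End Mean.

(** Each term of the convolution for (p * q)`_j, normalised by its coefficient at
    0, is at most the term for p' * q'.  Equality of the sums gives equality of
    the terms, of which the last is p`_j * q`_0. *)
Lemma coef_ratioM_eq p q p' q' j :
    nneg_poly p -> nneg_poly q -> nneg_poly p' -> nneg_poly q' ->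
    (forall x, p`_x * p'`_0 <= p'`_x * p`_0) ->
    (forall x, q`_x * q'`_0 <= q'`_x * q`_0) ->
    0 < q`_0 -> 0 < q'`_0 ->
  (p * q)`_j * (p' * q')`_0 = (p * q)`_0 * (p' * q')`_j ->
  p`_j * p'`_0 = p'`_j * p`_0.
Proof.
move=> p0 q0 p'0 q'0 pp qq qgt q'gt; rewrite !coef0M !coefM mulr_suml mulr_sumr.
move/esym/eqP; rewrite -subr_eq0 -sumrB => /eqP.
move/psumr_eq0P => H.
have /H/(_ ord_max isT)/eqP : forall i : 'I_j.+1, true ->
    0 <= p`_0 * q`_0 * (p'`_i * q'`_(j - i)) - p`_i * q`_(j - i) * (p'`_0 * q'`_0).
  move=> i _; rewrite subr_ge0.
  have -> : p`_i * q`_(j - i) * (p'`_0 * q'`_0) = (p`_i * p'`_0) * (q`_(j - i) * q'`_0) by ring.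
  have -> : p`_0 * q`_0 * (p'`_i * q'`_(j - i)) = (p'`_i * p`_0) * (q'`_(j - i) * q`_0) by ring.
  by apply: ler_pM => //; rewrite mulr_ge0.
rewrite /= subnn subr_eq0 => /eqP E.
apply: (mulIf (lt0r_neq0 (mulr_gt0 qgt q'gt))); move: E; rewrite !mulrA; lra.
Qed.
End Cumulative.

(** * The update map *)

Section BP.
Variables (R : realType) (V : finType) (adj : rel V).
Variable b : V -> nat.
Local Notation dedge := (dedge adj).
Local Notation messages := (messages adj R).
Implicit Types (m : messages) (d e : dedge).

(** Values beyond b_v cannot occur in a configuration allowed at v. *)
Definition mass_poly m d : {poly R} := \poly_(j < (b (ddst d)).+1) m d j.

Definition rest_poly m e : {poly R} := \prod_(d in dpred e) mass_poly m d.

(** Expanding the product of the generating functions lists the vectors y, and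
    the exponent of 'X records |y|. *)
Lemma bp_sumE m e x :
  bp_sum b m e x = (x <= b (dsrc e))%N%:R * cumcoef (rest_poly m e) (b (dsrc e) - x).
Proof.
set n := b (dsrc e).
have -> : rest_poly m e = \sum_(y : {ffun {d : dedge | d \in dpred e} -> 'I_n.+1})
    (\prod_d m (val d) (y d)) *: 'X^(\sum_d y d)%N.
  rewrite /rest_poly.
  under eq_bigr => d dP.
    have -> : mass_poly m d = \sum_(j < n.+1) m d j *: 'X^j.
      by rewrite /mass_poly poly_def; move: dP; rewrite inE => /andP[/eqP -> _].
    over.
  rewrite (big_sub _ (fun d => \sum_(j < n.+1) m d j *: 'X^j)) bigA_distr_bigA /=.
  apply: eq_bigr => y _; rewrite scaler_prod; congr (_ *: _).
  by rewrite -expr_sum.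
rewrite /bp_sum -/n; case: (leqP x n) => [xn|nx]; last first.
  by rewrite mul0r big_pred0 // => y; apply/negbTE; rewrite -ltnNge; lia.
rewrite mul1r /cumcoef; under [RHS]eq_bigr do rewrite coef_sum.
rewrite exchange_big /= big_mkcond /=; apply: eq_bigr => y _.
set s := (\sum_d y d)%N; under [RHS]eq_bigr do rewrite coefZ coefXn.
have -> : (s + x <= n)%N = (s < (n - x).+1)%N by lia.
case: ltnP => sn.
  rewrite (bigD1 (Ordinal sn)) //= eqxx mulr1 [X in _ + X]big1 ?addr0 // => j.
  by rewrite -val_eqE /= => /negbTE ->; rewrite mulr0.
rewrite [RHS]big1 // => j _; rewrite (_ : (_ == _) = false) ?mulr0 //.
by apply/negbTE; have := ltn_ord j; lia.
Qed.

(** What the argument uses of an initialization: it holds for messages in Ptilde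
    and is preserved by the update, whose normalising sums it makes positive. *)
Definition positive_at0 m := forall e, (forall x, 0 <= m e x) /\ 0 < m e 0%N.

Lemma mass_poly_nneg m d : positive_at0 m -> nneg_poly (mass_poly m d).
Proof. by move=> m0 i; rewrite coef_poly; case: ifP => // _; have [] := m0 d. Qed.

Lemma mass_poly0 m d : (mass_poly m d)`_0 = m d 0%N.
Proof. by rewrite coef_poly. Qed.

Lemma mass_polyE m d j : (j <= b (ddst d))%N -> (mass_poly m d)`_j = m d j.
Proof. by move=> jb; rewrite coef_poly ltnS jb. Qed.

Lemma rest_poly_nneg m e : positive_at0 m -> nneg_poly (rest_poly m e).
Proof. by move=> m0; apply: nneg_poly_prod => d; apply: mass_poly_nneg. Qed.

Lemma prod_mass_poly_gt0 (A : {pred dedge}) m : positive_at0 m ->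
  0 < (\prod_(d in A) mass_poly m d)`_0.
Proof.
move=> m0; rewrite coef0_prod; apply: prodr_gt0 => d _.
by rewrite mass_poly0; have [] := m0 d.
Qed.

Lemma bp_sum_ge0 m e x : positive_at0 m -> 0 <= bp_sum b m e x.
Proof.
by move=> m0; rewrite bp_sumE mulr_ge0 // cumcoef_ge0 //; apply: rest_poly_nneg.
Qed.

Lemma bp_sum_gt0 m e x : positive_at0 m -> (x <= b (dsrc e))%N -> 0 < bp_sum b m e x.
Proof.
move=> m0 xb; rewrite bp_sumE xb mul1r cumcoef_gt0 //; first exact: rest_poly_nneg.
exact: prod_mass_poly_gt0.
Qed.

Lemma Ptilde_positive m : (forall e, Ptilde (m e)) -> positive_at0 m.
Proof.
move=> mP e; have [m0 _ _ _ m00] := mP e; split=> //.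
by rewrite lt0r m00 m0.
Qed.

Lemma lru_mass_poly m m' d : positive_at0 m -> positive_at0 m' -> lru (m d) (m' d) ->
  lru (nth 0 (mass_poly m d)) (nth 0 (mass_poly m' d)).
Proof.
move=> m0 m'0 mm i k l; rewrite !coef_poly.
case: ltnP => [lt|_]; last first.
  by rewrite mul0r mulr_ge0 //; case: ifP => // _; [have [] := m0 d|have [] := m'0 d].
by rewrite !ifT //; lia.
Qed.

Variables (c : {set V} -> nat) (lambda : R).
Hypothesis lambda_gt0 : 0 < lambda.
Local Notation bp_update := (bp_update b c lambda).

Definition bp_norm m e := \sum_(t < (c (uedge e)).+1) lambda ^+ t * bp_sum b m e t.

Lemma bp_norm_gt0 m e : positive_at0 m -> 0 < bp_norm m e.
Proof.
move=> m0; rewrite /bp_norm big_ord_recl ltr_wpDr //.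
  apply: sumr_ge0 => t _; rewrite mulr_ge0 ?bp_sum_ge0 //.
  by rewrite exprn_ge0 // ltW.
by rewrite expr0 mul1r bp_sum_gt0.
Qed.

Lemma bp_updateE m e x : bp_update m e x =
  lambda ^+ x * (x <= c (uedge e))%N%:R * bp_sum b m e x / bp_norm m e.
Proof. by rewrite /bp_update /bp_norm big_mkord. Qed.

Definition normalized m := forall e,
  (forall x, (c (uedge e) < x)%N -> m e x = 0) /\
  \sum_(x < (c (uedge e)).+1) m e x = 1.

Lemma bp_update_ge0 m e x : positive_at0 m -> 0 <= bp_update m e x.
Proof.
move=> m0; rewrite bp_updateE mulr_ge0 ?invr_ge0 ?(ltW (bp_norm_gt0 _ m0)) //.
by rewrite !mulr_ge0 ?bp_sum_ge0 // exprn_ge0 // ltW.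
Qed.

Lemma bp_update_gt0 m e x : positive_at0 m ->
  (0 < bp_update m e x) = (x <= minn (c (uedge e)) (b (dsrc e)))%N.
Proof.
move=> m0; rewrite bp_updateE leq_min.
case: (leqP x (c _)) => [xc|_] /=; last by rewrite mulr0 !mul0r ltxx.
case: (leqP x (b _)) => [xb|xb] /=.
  by rewrite divr_gt0 ?bp_norm_gt0 // mulr1 mulr_gt0 ?exprn_gt0 ?bp_sum_gt0.
by rewrite bp_sumE leqNgt xb mul0r mulr0 mul0r ltxx.
Qed.

Lemma bp_update_positive m : positive_at0 m -> positive_at0 (bp_update m).
Proof.
by move=> m0 e; split=> [x|]; rewrite ?bp_update_ge0 // bp_update_gt0.
Qed.

Lemma bp_update_normalized m : positive_at0 m -> normalized (bp_update m).
Proof.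
move=> m0 e; split=> [x cx|].
  by rewrite bp_updateE leqNgt cx mulr0 !mul0r.
under eq_bigr => x _ do rewrite bp_updateE -ltnS ltn_ord mulr1.
by rewrite -mulr_suml divff // gt_eqF // bp_norm_gt0.
Qed.

Lemma bp_update_Ptilde m : positive_at0 m -> forall e, Ptilde (bp_update m e).
Proof.
move=> m0 e; have [zc s1] := bp_update_normalized m0 e.
have supp x : (bp_update m e x != 0) = (x <= minn (c (uedge e)) (b (dsrc e)))%N.
  by rewrite -(bp_update_gt0 _ _ m0) lt0r bp_update_ge0 // andbT.
split.
- by move=> x; apply: bp_update_ge0.
- apply: cvg_near_cst; exists (c (uedge e)).+1 => // n /= cn.
  rewrite seriesEord /= -s1; apply: (eq_sum_ord (F := bp_update m e)) => p.
  by rewrite geq_min => /orP[/(leq_trans cn)|] /zc.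
- by exists (c (uedge e)) => x; apply: contraNT; rewrite -ltnNge => /zc ->.
- by move=> i j k /andP[_ jk] _; rewrite !supp; apply: leq_trans.
- by rewrite supp.
Qed.

(** The argument of the cumulative sum is b - x, so the monotone dependence of
    the cumulative sums on the messages is reversed. *)
Lemma bp_update_antitone m m' : positive_at0 m -> positive_at0 m' ->
    (forall e, lru (m e) (m' e)) ->
  forall e, lru (bp_update m' e) (bp_update m e).
Proof.
move=> m0 m'0 mm e i k l; rewrite !bp_updateE.
set n := b (dsrc e); set C := c _.
have F0 m1 x : positive_at0 m1 ->
    0 <= lambda ^+ x * (x <= C)%N%:R * bp_sum b m1 e x / bp_norm m1 e.
  by move=> ?; rewrite /C -bp_updateE bp_update_ge0.
have [Ci|Ci] := leqP (i + k + l) C; last first.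
  by rewrite mulr0 !mul0r mulr_ge0 ?F0.
have [ni|ni] := leqP (i + k + l) n; last first.
  by rewrite [in X in X <= _]bp_sumE leqNgt -/n ni mul0r mulr0 !mul0r mulr_ge0 ?F0.
rewrite !bp_sumE -/n ni.
have -> : (i <= n)%N by lia.
have -> : (i + l <= n)%N by lia.
have -> : (i + k <= n)%N by lia.
have -> : (i <= C)%N by lia.
have -> : (i + l <= C)%N by lia.
have -> : (i + k <= C)%N by lia.
rewrite !mulr1 !mul1r.
have := @lru_cumcoef _ _ _ (rest_poly_nneg e m0) (rest_poly_nneg e m'0) _
  (n - (i + k + l))%N k l.
have -> : (n - (i + k + l) + k + l)%N = (n - i)%N by lia.
have -> : (n - (i + k + l) + l)%N = (n - (i + k))%N by lia.
have -> : (n - (i + k + l) + k)%N = (n - (i + l))%N by lia.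
move=> /(_ (lru_prod _ _ _ _)) H.
have {}H := H (fun d => mass_poly_nneg d m0) (fun d => mass_poly_nneg d m'0)
  (fun d => lru_mass_poly m0 m'0 (mm d)).
have K0 : 0 <= lambda ^+ (i + k + l) * lambda ^+ i / (bp_norm m e * bp_norm m' e).
  by rewrite divr_ge0 ?mulr_ge0 ?exprn_ge0 ?(ltW lambda_gt0) ?(ltW (bp_norm_gt0 _ _)).
have := ler_wpM2l K0 H; rewrite invfM !exprD.
set A := cumcoef _ _; set B := cumcoef _ _; set A' := cumcoef _ _; set B' := cumcoef _ _.
set u := (bp_norm m e)^-1; set u' := (bp_norm m' e)^-1.
by congr (is_true (_ <= _)); ring.
Qed.
End BP.

(** * Messages exchanged by the update *)

Section Period2.
Variables (R : realType) (V : finType) (adj : rel V).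
Hypothesis adj_sym : symmetric adj.
Variables (b : V -> nat) (c : {set V} -> nat) (lambda : R).
Hypothesis lambda_gt0 : 0 < lambda.
Local Notation dedge := (dedge adj).
Local Notation messages := (messages adj R).
Local Notation bp_update := (bp_update b c lambda).
Local Notation mass_poly := (mass_poly b).
Local Notation rest_poly := (rest_poly b).
Local Notation bp_norm := (bp_norm b c lambda).
Local Notation normalized := (normalized c).
Implicit Types (m : messages) (d e : dedge).

Lemma rev_subproof d : adj (ddst d) (dsrc d).
Proof. by rewrite adj_sym; exact: valP d. Qed.

Definition rev_edge d : dedge := Sub (ddst d, dsrc d) (rev_subproof d).

Lemma revK : involutive rev_edge.
Proof. by case=> -[u w] uw; apply: val_inj. Qed.

Lemma dsrc_rev d : dsrc (rev_edge d) = ddst d. Proof. by []. Qed.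

Lemma uedge_rev d : uedge (rev_edge d) = uedge d.
Proof. by rewrite /uedge /dsrc /ddst /= finset.setUC. Qed.

Definition in_edges v : {set dedge} := [set d | ddst d == v].

Definition vertex_poly m v : {poly R} := \prod_(d in in_edges v) mass_poly m d.

Lemma rest_poly_rev m d :
  rest_poly m (rev_edge d) = \prod_(j in in_edges (ddst d) | j != d) mass_poly m j.
Proof.
apply: eq_bigl => j; rewrite !inE /= {2}/dsrc /=.
have [jd /=|//] := eqVneq (ddst j) (ddst d).
congr (~~ _); apply/eqP/eqP => [js|-> //]; apply: val_inj.
by case: j d jd js => [[? ?] ?] [[? ?] ?]; rewrite /ddst /dsrc /= => -> ->.
Qed.

Lemma vertex_polyD m d : vertex_poly m (ddst d) = mass_poly m d * rest_poly m (rev_edge d).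
Proof. by rewrite rest_poly_rev /vertex_poly (bigD1 d) ?inE. Qed.

(** Under the product law of the messages entering v, conditioned to have a sum
    at most b_v, the value on d has weight m d x times the weight of the other
    edges, and the latter is the message on the reverse of d up to
    lambda ^+ x and normalisation.  The weight h serves for the mean (h x = x)
    and for the total mass (h x = 1). *)
Lemma edge_weight m d (h : nat -> R) : positive_at0 m -> normalized m ->
  \sum_(x < (b (ddst d)).+1)
     h x * ((mass_poly m d)`_x * cumcoef (rest_poly m (rev_edge d)) (b (ddst d) - x)) =
  bp_norm m (rev_edge d) * \sum_(x < (c (uedge d)).+1)
     h x * (m d x * bp_update m (rev_edge d) x / lambda ^+ x).
Proof.
move=> m0 m1; set n := b (ddst d).
pose F x := h x * (m d x * bp_sum b m (rev_edge d) x).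
transitivity (\sum_(x < n.+1) F x).
  apply: eq_bigr => x _; have xn : (x <= n)%N by rewrite -ltnS.
  by rewrite /F bp_sumE mass_polyE // dsrc_rev -/n xn mul1r.
(* F vanishes beyond b_v and beyond c, so both ranges give the same sum. *)
rewrite (@eq_sum_ord _ F _ (c (uedge d)).+1); last first.
  move=> x; rewrite geq_min /F => /orP[nx|cx].
    by rewrite bp_sumE dsrc_rev -/n leqNgt nx mul0r !mulr0.
  by have [-> //] := m1 d; rewrite mul0r mulr0.
rewrite mulr_sumr; apply: eq_bigr => x _; rewrite /F.
have xc : (x <= c (uedge d))%N by rewrite -ltnS.
rewrite bp_updateE uedge_rev xc mulr1; field.
by rewrite expf_neq0 ?gt_eqF // bp_norm_gt0.
Qed.

Definition edge_mean (n : nat) (f g : nat -> R) :=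
  (\sum_(x < n.+1) x%:R * (f x * g x / lambda ^+ x)) /
  (\sum_(x < n.+1) f x * g x / lambda ^+ x).

Lemma edge_meanC n f g : edge_mean n f g = edge_mean n g f.
Proof. by congr (_ / _); apply: eq_bigr => x _; rewrite [f x * _]mulrC. Qed.

Definition vertex_mean m v :=
  moment (vertex_poly m v) (b v) / cumcoef (vertex_poly m v) (b v).

Lemma vertex_poly_nneg m v : positive_at0 m -> nneg_poly (vertex_poly m v).
Proof. by move=> m0; apply: nneg_poly_prod => d; apply: mass_poly_nneg. Qed.

Lemma vertex_poly_gt0 m v : positive_at0 m -> 0 < (vertex_poly m v)`_0.
Proof. exact: prod_mass_poly_gt0. Qed.

Lemma cumcoef_vertex_gt0 m v n : positive_at0 m -> 0 < cumcoef (vertex_poly m v) n.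
Proof.
by move=> m0; rewrite cumcoef_gt0 ?vertex_poly_gt0 //; apply: vertex_poly_nneg.
Qed.

Lemma vertex_meanE m v : positive_at0 m -> normalized m ->
  vertex_mean m v = \sum_(d in in_edges v)
     edge_mean (c (uedge d)) (m d) (bp_update m (rev_edge d)).
Proof.
move=> m0 m1; rewrite /vertex_mean moment_prod mulr_suml.
apply: eq_bigr => d; rewrite inE => /eqP <-; rewrite -rest_poly_rev.
under eq_bigr do rewrite -mulrA.
rewrite (edge_weight d (fun x => x%:R)) // vertex_polyD cumcoefM.
under [X in _ / X]eq_bigr do rewrite -[_ * cumcoef _ _]mul1r.
rewrite (edge_weight d (fun=> 1)) // /edge_mean.
under [X in _ / (_ * X)]eq_bigr do rewrite mul1r.
by rewrite invfM mulrACA divff ?mul1r // gt_eqF // bp_norm_gt0.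
Qed.

Lemma sum_vertex_mean m : positive_at0 m -> normalized m ->
  \sum_v vertex_mean m v =
  \sum_d edge_mean (c (uedge d)) (m d) (bp_update m (rev_edge d)).
Proof.
move=> m0 m1; rewrite (partition_big (@ddst _ adj) predT) //=.
apply: eq_bigr => v _; rewrite vertex_meanE //; apply: eq_bigl => d.
by rewrite inE.
Qed.

(** When the update exchanges m and m', the value on an edge has the same mean
    seen from one end with the messages m and from the other end with m'. *)
Lemma sum_vertex_mean_sym m m' :
    positive_at0 m -> normalized m -> positive_at0 m' -> normalized m' ->
    m' = bp_update m -> m = bp_update m' ->
  \sum_v vertex_mean m v = \sum_v vertex_mean m' v.
Proof.
move=> m0 m1 m'0 m'1 Em' Em; rewrite !sum_vertex_mean // -Em -Em'.
rewrite (reindex_inj (inv_inj revK)) /=; apply: eq_bigr => d _.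
by rewrite revK uedge_rev edge_meanC.
Qed.

(** The update reads a message only up to b at the target of the edge, and only
    up to a factor. *)
Lemma bp_update_eq_ratio m m' : positive_at0 m -> positive_at0 m' ->
    (forall d j, (j <= b (ddst d))%N -> m d j * m' d 0%N = m' d j * m d 0%N) ->
  bp_update m = bp_update m'.
Proof.
move=> m0 m'0 mm'; apply/funext => e; apply/funext => x.
pose k d := m d 0%N / m' d 0%N.
pose K := \prod_(d in dpred e) k d.
have k0 d : k d != 0.
  by have [[_ ?] [_ ?]] := (m0 d, m'0 d); rewrite gt_eqF // divr_gt0.
have K0 : K != 0 by apply/prodf_neq0 => d _.
have restE : rest_poly m e = K *: rest_poly m' e.
  rewrite -scaler_prod; apply: eq_bigr => d _; apply/polyP => j.
  rewrite coefZ !coef_poly; case: ltnP => [jb|_]; last by rewrite mulr0.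
  have [_ p0] := m'0 d; apply: (mulIf (lt0r_neq0 p0)).
  by rewrite mm' // /k; field; rewrite gt_eqF.
have sumE t : bp_sum b m e t = K * bp_sum b m' e t.
  rewrite !bp_sumE restE mulrCA; congr (_ * _).
  by rewrite /cumcoef mulr_sumr; apply: eq_bigr => j _; rewrite coefZ.
have normE : bp_norm m e = K * bp_norm m' e.
  by rewrite mulr_sumr; apply: eq_bigr => t _; rewrite sumE mulrCA.
rewrite !bp_updateE sumE normE; field.
by rewrite K0 gt_eqF // bp_norm_gt0.
Qed.

(** The vertex means are ordered at each vertex and have the same sum, hence are
    equal; by the equality case of monotonicity the messages are proportional
    on the range that the update reads. *)
Lemma bp_period2_eq m m' :
    positive_at0 m -> normalized m -> positive_at0 m' -> normalized m' ->
    m' = bp_update m -> m = bp_update m' -> (forall e, lru (m e) (m' e)) ->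
  m = m'.
Proof.
move=> m0 m1 m'0 m'1 Em' Em mm'; rewrite Em {2}Em'; apply: bp_update_eq_ratio => //.
move=> d j jb.
pose v := ddst d.
have polymm e : lru (nth 0 (mass_poly m e)) (nth 0 (mass_poly m' e)).
  exact: lru_mass_poly.
have vmm w : lru (nth 0 (vertex_poly m w)) (nth 0 (vertex_poly m' w)).
  by apply: lru_prod => // e; apply: mass_poly_nneg.
have le_mean w : 0 <= vertex_mean m' w - vertex_mean m w.
  rewrite subr_ge0 /vertex_mean ler_pdivrMr ?cumcoef_vertex_gt0 //.
  rewrite mulrAC ler_pdivlMr ?cumcoef_vertex_gt0 //.
  exact: lru_moment.
have : \sum_w (vertex_mean m' w - vertex_mean m w) = 0.
  by rewrite sumrB (sum_vertex_mean_sym m0 m1 m'0 m'1) // subrr.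
move/psumr_eq0P => /(_ (fun w _ => le_mean w)) /(_ v isT) /eqP.
rewrite subr_eq0 /vertex_mean eqr_div ?(lt0r_neq0 (cumcoef_vertex_gt0 _ _ _)) //.
move/eqP => E.
have := lru_moment_eq (vmm v) (esym E) jb.
rewrite /v !vertex_polyD => prodE.
rewrite -(mass_polyE m jb) -(mass_polyE m' jb) -(mass_poly0 b m) -(mass_poly0 b m').
apply: (esym (coef_ratioM_eq _ _ _ _ _ _ _ _ prodE)).
- exact: mass_poly_nneg.
- exact: rest_poly_nneg.
- exact: mass_poly_nneg.
- exact: rest_poly_nneg.
- by move=> x; have := lru_at0 x (polymm d); rewrite !mass_poly0.
- move=> x; apply: (lru_at0 (f := nth 0 _) (g := nth 0 _)).
  by apply: lru_prod => // e; apply: mass_poly_nneg.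
- exact: prod_mass_poly_gt0.
- exact: prod_mass_poly_gt0.
Qed.
End Period2.

(** * Convergence *)

Lemma cvgn_const (R : realType) (u : nat -> R) (a l : R) :
  (forall t, u t = a) -> u @ \oo --> l -> l = a.
Proof.
move=> ua ul; apply: cvg_unique ul _ => //.
by rewrite (_ : u = fun=> a); [exact: cvg_cst|exact/funext].
Qed.

Section FiniteLimits.
Variables (R : realType) (I : Type).
Implicit Types (u : nat -> I -> R) (l : I -> R).

Lemma cvgn_sum u l (r : seq I) (P : pred I) : (forall i, u ^~ i @ \oo --> l i) ->
  (fun n => \sum_(i <- r | P i) u n i) @ \oo --> \sum_(i <- r | P i) l i.
Proof.
move=> ul; elim: r => [|i r IH].
  by under eq_fun do rewrite big_nil; rewrite big_nil; apply: cvg_cst.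
under eq_fun do rewrite big_cons; rewrite big_cons.
by case: (P i) => //; apply: cvgD.
Qed.

Lemma cvgn_prod u l (r : seq I) (P : pred I) : (forall i, u ^~ i @ \oo --> l i) ->
  (fun n => \prod_(i <- r | P i) u n i) @ \oo --> \prod_(i <- r | P i) l i.
Proof.
move=> ul; elim: r => [|i r IH].
  by under eq_fun do rewrite big_nil; rewrite big_nil; apply: cvg_cst.
under eq_fun do rewrite big_cons; rewrite big_cons.
by case: (P i) => //; apply: cvgM.
Qed.
End FiniteLimits.

Section Convergence.
Variables (R : realType) (V : finType) (adj : rel V).
Hypothesis adj_sym : symmetric adj.
Variables (b : V -> nat) (c : {set V} -> nat) (lambda : R).
Hypothesis lambda_gt0 : 0 < lambda.
Local Notation dedge := (dedge adj).
Local Notation messages := (messages adj R).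
Local Notation bp_update := (bp_update b c lambda).
Local Notation normalized := (normalized c).
Implicit Types (m L : messages) (d e : dedge) (u : nat -> messages).

Local Notation "u ~~> L" := (forall e x, (fun t => u t e x) @ \oo --> (L e x : R))
  (at level 70).

Lemma bp_update_cvg u L : positive_at0 L -> u ~~> L -> (fun t => bp_update (u t)) ~~> bp_update L.
Proof.
move=> L0 uL e x; rewrite bp_updateE.
have sumL y : (fun t => bp_sum b (u t) e y) @ \oo --> bp_sum b L e y.
  by apply: cvgn_sum => f; apply: cvgn_prod => d; apply: uL.
under eq_fun do rewrite bp_updateE.
apply: cvgM; first by apply: cvgM => //; apply: cvg_cst.
apply: cvgV; first by rewrite gt_eqF // bp_norm_gt0.
by apply: cvgn_sum => t; apply: cvgM => //; apply: cvg_cst.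
Qed.

(** Comparison in the order becomes a pointwise inequality for these ratios, and
    [ratio_normalized] recovers normalised messages from them. *)
Definition ratio m e x := m e x / m e 0%N.

Lemma ratio_ge0 m e x : positive_at0 m -> 0 <= ratio m e x.
Proof. by move=> m0; have [? ?] := m0 e; rewrite divr_ge0. Qed.

Lemma lru_ratio m m' e x : positive_at0 m -> positive_at0 m' -> lru (m e) (m' e) ->
  ratio m e x <= ratio m' e x.
Proof.
move=> m0 m'0 /(lru_at0 x) mm'; have [[_ p] [_ p']] := (m0 e, m'0 e).
by rewrite /ratio ler_pdivrMr // mulrAC ler_pdivlMr.
Qed.

Lemma ratio_normalized m e x : positive_at0 m -> normalized m ->
  m e x = ratio m e x / \sum_(y < (c (uedge e)).+1) ratio m e y.
Proof.
move=> m0 m1; have [_ me0] := m0 e.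
rewrite -mulr_suml (proj2 (m1 e)) mul1r /ratio; field.
by rewrite gt_eqF.
Qed.

(** Ratios at 0 are 1, so the limiting normalising sums are at least 1: no mass
    is lost and pointwise convergence passes from the ratios to the messages. *)
Lemma ratio_limit u (r : dedge -> nat -> R) :
    (forall t, positive_at0 (u t)) -> (forall t, normalized (u t)) ->
    (fun t => ratio (u t)) ~~> r ->
  exists L, [/\ positive_at0 L, normalized L, u ~~> L & ratio L = r].
Proof.
move=> u0 u1 ur.
pose S e := \sum_(y < (c (uedge e)).+1) r e y.
have r_ge0 e x : 0 <= r e x.
  apply: ler_cvg_to (cvg_cst 0) (ur e x) _.
  by apply: nearW => t; apply: ratio_ge0.
have r0 e : r e 0%N = 1.
  apply: cvgn_const (ur e 0%N) => t.
  by rewrite /ratio divff ?(lt0r_neq0 (proj2 (u0 t e))).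
have S0 e : 0 < S e.
  by rewrite /S big_ord_recl r0 ltr_wpDr // sumr_ge0.
exists (fun e x => r e x / S e); split.
- move=> e; split=> [x|]; first exact: divr_ge0 (r_ge0 e x) (ltW (S0 e)).
  by rewrite r0; exact: divr_gt0 ltr01 (S0 e).
- move=> e; split=> [x cx|]; last first.
    by rewrite -mulr_suml divff //; exact: lt0r_neq0 (S0 e).
  suff -> : r e x = 0 by rewrite mul0r.
  by apply: cvgn_const (ur e x) => t; rewrite /ratio (proj1 (u1 t e)) // mul0r.
- move=> e x; under eq_fun do rewrite ratio_normalized //.
  apply: cvgM; first exact: ur.
  by apply: cvgV; [rewrite gt_eqF|apply: cvgn_sum => y; apply: ur].
- apply/funext => e; apply/funext => x; rewrite /ratio r0; field.
  by rewrite gt_eqF.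
Qed.

Definition delta0 : messages := fun e x => (x == 0%N)%:R.

Lemma delta0_positive : positive_at0 delta0.
Proof. by move=> e; split=> [x|]; rewrite /delta0 ?ler0n ?ltr01. Qed.

Lemma delta0_normalized : normalized delta0.
Proof.
move=> e; split=> [[|x]//|].
by rewrite big_ord_recl big1 ?addr0 // => i _; rewrite /delta0.
Qed.

Lemma lru_delta0 m e : positive_at0 m -> lru (delta0 e) (m e).
Proof.
move=> m0; have [mge0 _] := m0 e; rewrite /lru /delta0.
by case=> [|i] [|k] [|l] //=; rewrite ?addn0 ?mul0r ?mulr_ge0.
Qed.

Local Notation iterate t m := (iter t bp_update m).

Lemma iterate_positive t m : positive_at0 m -> positive_at0 (iterate t m).
Proof. by move=> m0; elim: t => //= t; apply: bp_update_positive. Qed.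

Lemma iterate_normalized t m :
  positive_at0 m -> normalized m -> normalized (iterate t m).
Proof.
by move=> m0 m1; case: t => //= t; apply/bp_update_normalized/iterate_positive.
Qed.

(** The point mass at 0 is below every iterate of m, and each update reverses
    the inequality. *)
Lemma iterate_sandwich m t j e : positive_at0 m ->
  if odd t then lru (iterate (t + j) m e) (iterate t delta0 e)
  else lru (iterate t delta0 e) (iterate (t + j) m e).
Proof.
move=> m0; elim: t e => [|t IH] e /=; first exact/lru_delta0/iterate_positive.
have [p p0] := (iterate_positive (t + j) m0, iterate_positive t delta0_positive).
by case: (odd t) IH => /= IH; apply: bp_update_antitone.
Qed.

Lemma ratio_even m t j e x : positive_at0 m ->
  ratio (iterate t.*2 delta0) e x <= ratio (iterate (t.*2 + j) m) e x.
Proof.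
move=> m0; apply: lru_ratio; first exact: iterate_positive delta0_positive.
  exact: iterate_positive.
by have := iterate_sandwich t.*2 j e m0; rewrite odd_double.
Qed.

Lemma ratio_odd m t j e x : positive_at0 m ->
  ratio (iterate (t.*2.+1 + j) m) e x <= ratio (iterate t.*2.+1 delta0) e x.
Proof.
move=> m0; apply: lru_ratio; try exact: iterate_positive delta0_positive.
  exact: iterate_positive.
by have := iterate_sandwich t.*2.+1 j e m0; rewrite /= odd_double.
Qed.

(** The even and the odd iterates of the point mass at 0 have monotone ratios,
    so they converge; the update exchanges the limits, which are ordered, hence
    equal by [bp_period2_eq]. *)
Lemma even_odd_limit : exists L, [/\ positive_at0 L, normalized L,
  bp_update L = L,
  (fun t => ratio (iterate t.*2 delta0)) ~~> ratio L &
  (fun t => ratio (iterate t.*2.+1 delta0)) ~~> ratio L].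
Proof.
have d0 := delta0_positive.
have p t : positive_at0 (iterate t delta0) by apply: iterate_positive.
have n t : normalized (iterate t delta0).
  exact: iterate_normalized delta0_normalized.
have cvg_even e x : cvgn (fun t => ratio (iterate t.*2 delta0) e x).
  apply: nondecreasing_is_cvgn.
    move=> s t st; have := ratio_even s (t.*2 - s.*2) e x d0.
    by rewrite subnKC // leq_double.
  exists (ratio (iterate 1 delta0) e x) => _ [[|t] _ <-].
    exact: (ratio_even 0 1 e x d0).
  have := ratio_odd 0 t.*2.+1 e x d0; by rewrite add1n.
have cvg_odd e x : cvgn (fun t => ratio (iterate t.*2.+1 delta0) e x).
  apply: nonincreasing_is_cvgn.
    move=> s t st; have := ratio_odd s (t.*2 - s.*2) e x d0.
    by rewrite addSn subnKC // leq_double.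
  by exists 0 => _ [t _ <-]; apply: ratio_ge0.
have [L [L0 L1 uL rL]] := ratio_limit (fun t => p t.*2) (fun t => n t.*2) cvg_even.
have [L' [L'0 L'1 uL' rL']] :=
  ratio_limit (fun t => p t.*2.+1) (fun t => n t.*2.+1) cvg_odd.
have EL' : L' = bp_update L.
  apply/funext => e; apply/funext => x.
  exact: cvg_unique (uL' e x) (bp_update_cvg L0 uL (e := e) (x := x)).
have EL : L = bp_update L'.
  apply/funext => e; apply/funext => x.
  apply: cvg_unique (bp_update_cvg L'0 uL' (e := e) (x := x)) => //.
  by have := uL e x; rewrite -cvg_shiftS.
have LL' e : lru (L e) (L' e).
  move=> i k l.
  apply: ler_cvg_to (cvgM (uL e _) (uL' e _)) (cvgM (uL e _) (uL' e _)) _.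
  apply: nearW => t; have := iterate_sandwich t.*2 1 e d0.
  by rewrite odd_double addn1; apply.
have LE := bp_period2_eq adj_sym lambda_gt0 L0 L1 L'0 L'1 EL' EL LL'.
exists L; split=> //; first by rewrite -EL' -LE.
- by rewrite rL => e x; apply: cvg_even.
- by rewrite LE rL' => e x; apply: cvg_odd.
Qed.

(** From time N.*2.+1 on, the ratios of any trajectory lie between those of the
    iterates N.*2 and N.*2.+1 of the point mass at 0. *)
Lemma bp_converge : exists L, [/\ positive_at0 L, bp_update L = L &
  forall m, positive_at0 m -> (fun t => iterate t m) ~~> L].
Proof.
have [L [L0 L1 LE even odd]] := even_odd_limit.
exists L; split=> // m m0.
pose w t := iterate t.+1 m.
have w0 t : positive_at0 (w t) by apply: iterate_positive.
have w1 t : normalized (w t) by exact/bp_update_normalized/iterate_positive.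
have wr : (fun t => ratio (w t)) ~~> ratio L.
  move=> e x; apply/cvgrPdist_lt => eps eps0.
  have /cvgrPdist_lt/(_ eps eps0) [N1 _ H1] := even e x.
  have /cvgrPdist_lt/(_ eps eps0) [N2 _ H2] := odd e x.
  pose N := maxn N1 N2.
  have {}H1 := H1 N (leq_maxl _ _); have {}H2 := H2 N (leq_maxr _ _).
  exists N.*2 => // t /= Nt.
  have h1 := ratio_even N (t.+1 - N.*2) e x m0.
  have h2 := ratio_odd N (t - N.*2) e x m0.
  rewrite subnKC ?leqW // in h1; rewrite addSn subnKC // in h2.
  move: H1 H2 h1 h2; rewrite /w /=.
  rewrite !ltr_norml => /andP[? ?] /andP[? ?] ? ?; apply/andP; split; lra.
have [L' [L'0 L'1 wL' rL']] := ratio_limit w0 w1 wr.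
have -> : L = L'.
  apply/funext => e; apply/funext => x.
  by rewrite ratio_normalized // [in RHS]ratio_normalized // rL'.
by move=> e x; rewrite -cvg_shiftS; apply: wL'.
Qed.
End Convergence.

(** * Existence, uniqueness and global convergence *)

Theorem proposition5 (R : realType) (V : finType) (adj : rel V)
    (adj_sym : symmetric adj) (adj_irr : irreflexive adj)
    (b : V -> nat) (c : {set V} -> nat) (lambda : R) (lambda_gt0 : 0 < lambda) :
  exists ml : messages adj R,
    unique (fun m : messages adj R =>
      (forall e, Ptilde (m e)) /\ m = bp_update b c lambda m) ml
    /\ forall m : nat -> messages adj R,
         (forall e, Ptilde (m 0%N e)) ->
         (forall t, m t.+1 = bp_update b c lambda (m t)) ->
         forall e x, (fun t => m t e x) @ \oo --> ml e x.
Proof.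
have [L [L0 LE cvgL]] := bp_converge adj_sym b c lambda_gt0.
exists L; split; first split.
- by split=> [e|//]; rewrite -LE; apply: bp_update_Ptilde.
- move=> m [/Ptilde_positive m0 mE]; apply/funext => e; apply/funext => x.
  have iterE t : iter t (bp_update b c lambda) m = m by elim: t => //= t ->.
  by apply: cvgn_const (cvgL m m0 e x) => t; rewrite iterE.
move=> m /Ptilde_positive m0 mS e x.
have mE t : m t = iter t (bp_update b c lambda) (m 0%N).
  by elim: t => //= t <-.
by under eq_fun do rewrite mE; apply: cvgL.
Qed.
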